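(* Let $A,B\in \mathbb{C}^{n\times n}$ be group matrices such that $A^{\mathrm{core}}B=0$ (that is, $A$ is left core-orthogonal to $B$). Then $(A+B)^{\mathrm{core}} =A^{\mathrm{core}}+B^{\mathrm{core}}$ if and only if $BA^{\mathrm{core}}=0$ and $AB^{\mathrm{core}}=0$ (that is, $A$ is right core-orthogonal to $B$ and $B$ is right core-orthogonal to $A$).
   Context: A square matrix $M$ is a group matrix if it has index at most $1$, i.e. $\operatorname{rank}(M)=\operatorname{rank}(M^2)$. The core inverse $M^{\mathrm{core}}$ of a square matrix $M$ is the unique matrix $X$ (when it exists) with $MX=MM^\dagger$ and $\mathcal{R}(X)\subseteq\mathcal{R}(M)$, where $M^\dagger$ is the Moore-Penrose inverse and $\mathcal{R}$ denotes column space; it exists if and only if $M$ is a group matrix. The equality $(A+B)^{\mathrm{core}} =A^{\mathrm{core}}+B^{\mathrm{core}}$ means that $A+B$ has a core inverse and it equals the right-hand side. *)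

(* Defs.v *)
From mathcomp Require Import all_boot all_order all_algebra.
From mathcomp Require Import boolp classical_sets reals complex.

Set Implicit Arguments.
Unset Strict Implicit.
Unset Printing Implicit Defensive.

Import Order.TTheory GRing.Theory Num.Theory.

Local Open Scope ring_scope.
Local Open Scope sesquilinear_scope.

Definition group_matrix (C : numClosedFieldType) (n : nat) (M : 'M[C]_n) : Prop :=
  \rank M = \rank (M *m M).

(* The four Penrose equations; [^t*] is the conjugate transpose. *)
Definition is_moore_penrose (C : numClosedFieldType) (n : nat)
    (M X : 'M[C]_n) : Prop :=
  [/\ M *m X *m M = M,
      X *m M *m X = X,
      (M *m X) ^t* = M *m X &
      (X *m M) ^t* = X *m M].

(* [xget 0] picks the matrix satisfying the property, or 0 if there is none. *)
Definition moore_penrose (C : numClosedFieldType) (n : nat) (M : 'M[C]_n) : 'M[C]_n :=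
  xget 0 [set X : 'M[C]_n | is_moore_penrose M X]%classic.

(* [<=] in [%MS] compares row spaces, so the inclusion of column spaces
   R(X) <= R(M) is the inclusion of the row spaces of the transposes. *)
Definition is_core_inverse (C : numClosedFieldType) (n : nat)
    (M X : 'M[C]_n) : Prop :=
  M *m X = M *m moore_penrose M /\ (X^T <= M^T)%MS.

Definition has_core_inverse (C : numClosedFieldType) (n : nat) (M : 'M[C]_n) : Prop :=
  exists! X : 'M[C]_n, is_core_inverse M X.

(* Takes the junk value 0 when [M] has no core inverse. *)
Definition core_inverse (C : numClosedFieldType) (n : nat) (M : 'M[C]_n) : 'M[C]_n :=
  xget 0 [set X : 'M[C]_n | is_core_inverse M X]%classic.

(* Main.v *)
(** If X = A^core and Y = B^core, then A^core B = 0 forces A^* B = 0, so the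
    ranges of A and B are orthogonal and XY = YX = YA = 0.  If moreover BX = 0
    and AY = 0, then AB = BA = 0 and X + Y satisfies the equations
    MZM = M, (MZ)^* = MZ, MZ^2 = Z characterizing M^core for M = A + B.
    Conversely, for M^core = X + Y the equation MZ^2 = Z reduces to
    AY^2 + BX^2 = 0; multiplying by B^3 on the right kills the second term
    (as XB = 0) and leaves AB = 0, whence AY = 0, BX^2 = 0 and BX = 0. *)

Require Import Defs.
From mathcomp Require Import all_boot all_order all_algebra.
From mathcomp Require Import boolp classical_sets reals complex.

Set Implicit Arguments.
Unset Strict Implicit.
Unset Printing Implicit Defensive.

Import GRing.Theory Num.Theory.

Local Open Scope ring_scope.
Local Open Scope sesquilinear_scope.

Lemma adjmxM (C : numClosedFieldType) m n p (A : 'M[C]_(m, n)) (B : 'M[C]_(n, p)) :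
  (A *m B) ^t* = B ^t* *m A ^t*.
Proof. by rewrite trmx_mul map_mxM. Qed.

(** Each diagonal entry of A^* A is the sum of the squared moduli of a column of A, so every term
    vanishes. *)
Lemma adjmx_mul_eq0 (C : numClosedFieldType) m n (A : 'M[C]_(m, n)) :
  A ^t* *m A = 0 -> A = 0.
Proof.
move=> /matrixP A0; apply/matrixP => i j; rewrite mxE.
have := A0 j j; rewrite !mxE.
under eq_bigr => k _ do rewrite !mxE mulrC.
move=> /psumr_eq0P Aj; apply/eqP; rewrite -mul_conjC_eq0; apply/eqP.
by apply: Aj => // k _; exact: mul_conjC_ge0.
Qed.

Lemma adjmx_mul_inj (C : numClosedFieldType) m n p (A : 'M[C]_(m, n)) (X Y : 'M[C]_(n, p)) :
  A ^t* *m A *m X = A ^t* *m A *m Y -> A *m X = A *m Y.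
Proof.
move=> eXY; apply/eqP; rewrite -subr_eq0 -mulmxBr; apply/eqP/adjmx_mul_eq0.
by rewrite adjmxM -!mulmxA (mulmxA _ A) mulmxBr eXY subrr mulmx0.
Qed.

(* With H = A^* A and G a generalized inverse of H, the matrix G A^* works. *)
Lemma hermitian_ginv_exists (C : numClosedFieldType) n (A : 'M[C]_n) :
  exists X : 'M[C]_n, A *m X *m A = A /\ (A *m X) ^t* = A *m X.
Proof.
set H := A ^t* *m A.
have [G HGH] : exists G, H *m G *m H = H by exists (pinvmx H); exact: mulmxKpV.
have AXA : A *m (G *m A ^t*) *m A = A.
  rewrite -[RHS]mulmx1 -!mulmxA; apply: adjmx_mul_inj.
  by rewrite mulmx1 -[RHS]HGH -!mulmxA.
exists (G *m A ^t*); split=> //.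
set P := A *m _ in AXA *.
(* P A = A gives A^* P^* = A^*. Since P = A G A^*, this yields P P^* = P, so P is Hermitian. *)
have AP : A ^t* *m P ^t* = A ^t* by rewrite -adjmxM AXA.
have PP : P *m P ^t* = P by rewrite {1}/P -!mulmxA AP.
by rewrite -[in RHS]PP -[in LHS]PP adjmxM trmxCK.
Qed.

Lemma moore_penroseP (C : numClosedFieldType) n (A : 'M[C]_n) :
  is_moore_penrose A (moore_penrose A).
Proof.
apply: (xgetPex (0 : 'M[C]_n)).
have [X [AXA AXh]] := hermitian_ginv_exists A.
(* Its adjoint Y satisfies A Y A = A with Y A Hermitian. Then Y A X combines both sides: A (Y A X) =
   A X and (Y A X) A = Y A. *)
have [Z [AZA AZh]] := hermitian_ginv_exists (A ^t*).
have AYA : A *m Z ^t* *m A = A.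
  by have := congr1 (fun M => M ^t*) AZA; rewrite !adjmxM !trmxCK mulmxA.
have YAh : (Z ^t* *m A) ^t* = Z ^t* *m A.
  by rewrite adjmxM trmxCK -AZh adjmxM trmxCK.
move: {Z AZA AZh} (Z ^t*) AYA YAh => Y AYA YAh.
have AYAX : A *m (Y *m A *m X) = A *m X by rewrite !mulmxA AYA.
have YAXA : Y *m A *m X *m A = Y *m A by rewrite -!mulmxA (mulmxA A) AXA.
exists (Y *m A *m X); split; rewrite ?AYAX ?YAXA //.
by rewrite !mulmxA -(mulmxA Y A Y) -(mulmxA Y) AYA.
Qed.

(* M X and M M^+ are both the orthogonal projector onto the range of M. *)
Lemma mulmx_moore_penrose (C : numClosedFieldType) n (M X : 'M[C]_n) :
  M *m X *m M = M -> (M *m X) ^t* = M *m X -> M *m X = M *m moore_penrose M.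
Proof.
have [MPM _ MPh _] := moore_penroseP M.
move=> MXM MXh.
(* With P = M X and Q = M M^+: P = P^* = (Q P)^* = P Q = Q. *)
rewrite -[LHS]MXh -[in LHS]MPM -mulmxA adjmxM MXh MPh.
by rewrite mulmxA MXM.
Qed.

(** The range condition becomes M X X = X: the projector M X = M M^+ fixes the range of M, and
    conversely X = M (X X) lies in it. *)
Lemma is_core_inverseP (C : numClosedFieldType) n (M X : 'M[C]_n) :
  is_core_inverse M X <->
  [/\ M *m X *m M = M, (M *m X) ^t* = M *m X & M *m X *m X = X].
Proof.
have [MPM _ MPh _] := moore_penroseP M.
split=> [[MX /submxP[W /(congr1 trmx)]]|[MXM MXh MXX]].
  rewrite trmx_mul !trmxK => XW; rewrite MX; split=> //.
  by rewrite [X in _ *m X = _]XW mulmxA MPM -XW.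
split; first exact: mulmx_moore_penrose.
by rewrite -[X in (X^T <= _)%MS]MXX -mulmxA trmx_mul submxMl.
Qed.

(** Substituting X = M X X in M = M X M gives M = M^2 (X^2 M), so M and M^2 have equal rank and
    hence the same row space. *)
Lemma is_core_inverse_left_divisor (C : numClosedFieldType) n (M X : 'M[C]_n) :
  is_core_inverse M X -> exists U, U *m M *m M = M.
Proof.
move=> /is_core_inverseP[MXM _ MXX].
have: (\rank M <= \rank (M *m M))%N.
  have {1}-> : M = M *m M *m (X *m X *m M) by rewrite -[LHS]MXM -{1}MXX !mulmxA.
  exact: mxrankM_maxl.
rewrite (geq_leqif (mxrank_leqif_sup (submxMl M M))) => /submxP[U MU].
by exists U; rewrite -mulmxA.
Qed.

Lemma is_core_inverse_mulmx_sqr (C : numClosedFieldType) n (M X : 'M[C]_n) :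
  is_core_inverse M X -> X *m M *m M = M.
Proof.
move=> coreX; have [U UMM] := is_core_inverse_left_divisor coreX.
have [MXM _ MXX] := (is_core_inverseP _ _).1 coreX.
have <- : U *m (M *m X) = X by rewrite -[in LHS]MXX !mulmxA UMM.
by rewrite -(mulmxA U) MXM.
Qed.

(** X is recovered as U (M X), and M X = M M^+ depends on M alone. *)
Lemma is_core_inverse_unique (C : numClosedFieldType) n (M X Y : 'M[C]_n) :
  is_core_inverse M X -> is_core_inverse M Y -> X = Y.
Proof.
move=> coreX coreY; have [U UMM] := is_core_inverse_left_divisor coreX.
have UM Z : is_core_inverse M Z -> U *m (M *m Z) = Z.
  by move=> /is_core_inverseP[_ _ MZZ]; rewrite -[in LHS]MZZ !mulmxA UMM.
by rewrite -(UM X) // -(UM Y) // coreX.1 coreY.1.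
Qed.

Lemma group_matrix_core_inverse (C : numClosedFieldType) n (M : 'M[C]_n) :
  group_matrix M -> is_core_inverse M (core_inverse M).
Proof.
move=> gM; apply: (xgetPex (0 : 'M[C]_n)).
have /submxP[W MW] : (M^T <= (M *m M)^T)%MS.
  have sub : ((M *m M)^T <= M^T)%MS by rewrite trmx_mul submxMl.
  by rewrite -(geq_leqif (mxrank_leqif_sup sub)) !mxrank_tr gM.
move/(congr1 trmx): MW; rewrite trmx_mul !trmxK => MW.
(* Equal ranks gave M = M^2 W^T, hence M (M W^T M^+) = M M^+. *)
exists (M *m (W^T *m moore_penrose M)); split.
  by rewrite !mulmxA -MW.
by rewrite trmx_mul submxMl.
Qed.

Lemma core_inverse_eqP (C : numClosedFieldType) n (M X : 'M[C]_n) :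
  has_core_inverse M /\ core_inverse M = X <-> is_core_inverse M X.
Proof.
split=> [[[Y [coreY _]] <-]|coreX].
  by apply: (xgetPex (0 : 'M[C]_n)); exists Y.
split; first by exists X; split=> // Y; exact: is_core_inverse_unique.
by apply: xget_unique => // Y coreY; exact: is_core_inverse_unique coreY coreX.
Qed.

(** Each of X and A^* is a left multiple of the other: A^* = A^* A X and X = X A X = X X^* A^*. *)
Lemma core_orthogonal_adjmx (C : numClosedFieldType) n (A B X : 'M[C]_n) :
  is_core_inverse A X -> X *m B = 0 <-> A ^t* *m B = 0.
Proof.
move=> coreX; have XAA := is_core_inverse_mulmx_sqr coreX.
have [AXA AXh AXX] := (is_core_inverseP _ _).1 coreX.
split=> [XB0|AB0]; first by rewrite -[in LHS]AXA adjmxM AXh -!mulmxA XB0 !mulmx0.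
have <- : X *m (A *m X) = X by rewrite -[T in A *m T]AXX !mulmxA XAA.
by rewrite -AXh adjmxM -!mulmxA AB0 !mulmx0.
Qed.

Lemma core_inverse_add (C : numClosedFieldType) n (A B X Y : 'M[C]_n) :
  is_core_inverse A X -> is_core_inverse B Y -> X *m B = 0 ->
  is_core_inverse (A + B) (X + Y) <-> B *m X = 0 /\ A *m Y = 0.
Proof.
move=> coreX coreY XB0.
have YA0 : Y *m A = 0.
  (* Orthogonality of ranges is symmetric: B^* A is the adjoint of A^* B. *)
  apply: (core_orthogonal_adjmx _ coreY).2.
  rewrite -[LHS]trmxCK adjmxM trmxCK.
  by rewrite ((core_orthogonal_adjmx _ coreX).1 XB0) trmx0 map_mx0.
have XAA := is_core_inverse_mulmx_sqr coreX.
have YBB := is_core_inverse_mulmx_sqr coreY.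
have [AXA AXh AXX] := (is_core_inverseP _ _).1 coreX.
have [BYB BYh BYY] := (is_core_inverseP _ _).1 coreY.
have XY0 : X *m Y = 0 by rewrite -[Y]BYY !mulmxA XB0 !mul0mx.
have YX0 : Y *m X = 0 by rewrite -[X]AXX !mulmxA YA0 !mul0mx.
split=> [/is_core_inverseP[_ _ eqZ]|[BX0 AY0]].
  have cross0 : A *m Y *m Y + B *m X *m X = 0.
    have ZZ : (X + Y) *m (X + Y) = X *m X + Y *m Y.
      by rewrite mulmxDl !mulmxDr XY0 YX0 addr0 add0r.
    move: eqZ; rewrite -mulmxA ZZ mulmxDl !mulmxDr !mulmxA AXX BYY.
    by move=> eqZ; apply: (@addrI _ (X + Y)); rewrite addr0 addrACA [Y + _]addrC.
  have AB0 : A *m B = 0.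
    (* Using B = Y B^2 twice, A B = A Y^2 B^3, where A Y^2 = - B X^2. *)
    have <- : A *m Y *m (Y *m B *m B) *m B = A *m B.
      by rewrite YBB -(mulmxA A Y) -mulmxA YBB.
    rewrite !mulmxA (canRL (addrK _) cross0) sub0r !mulNmx.
    by rewrite -(mulmxA _ X B) XB0 mulmx0 !mul0mx oppr0.
  have AY0 : A *m Y = 0 by rewrite -[Y]BYY !mulmxA AB0 !mul0mx.
  move: cross0; rewrite AY0 mul0mx add0r => BXX0.
  have BA0 : B *m A = 0.
    (* Likewise A = X^2 A^3, so B X^2 = 0 forces B A = 0. *)
    have <- : X *m (X *m A *m A) *m A = A by rewrite !XAA.
    by rewrite !mulmxA BXX0 !mul0mx.
  by split=> //; rewrite -[X]AXX !mulmxA BA0 !mul0mx.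
(* The product is the sum of the orthogonal projectors onto the ranges of A and B; the remaining
   cross terms die by XB = YA = XY = YX = 0. *)
have MZ : (A + B) *m (X + Y) = A *m X + B *m Y.
  by rewrite mulmxDl !mulmxDr BX0 AY0 add0r addr0.
apply/is_core_inverseP; rewrite MZ; split.
- rewrite mulmxDl !mulmxDr AXA BYB -(mulmxA A) -(mulmxA B) XB0 YA0 !mulmx0.
  by rewrite addr0 add0r.
- by rewrite linearD map_mxD AXh BYh.
rewrite mulmxDl !mulmxDr AXX BYY -(mulmxA A) -(mulmxA B) XY0 YX0 !mulmx0.
by rewrite addr0 add0r.
Qed.

Theorem theorem3p10 (R : realType) (n : nat) (A B : 'M[R[i]]_n)
    (hA : group_matrix A) (hB : group_matrix B)
    (hAB : core_inverse A *m B = 0) :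
  (has_core_inverse (A + B) /\
   core_inverse (A + B) = core_inverse A + core_inverse B)
  <->
  (B *m core_inverse A = 0 /\ A *m core_inverse B = 0).
Proof.
rewrite core_inverse_eqP.
by apply: core_inverse_add => //; exact: group_matrix_core_inverse.
Qed.
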